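(* For the multi-ion magnetohydrodynamics variables $\mathbf u=(\rho_k,\rho_k\vec v_k,E_k,\vec B)_{k=1,\dots,N_i}$ with $E_k=\mathcal E_k+\tfrac12\|\vec B\|^2$, consider the function $$S(\mathbf u)=\sum_{k=1}^{N_i}\frac{-\rho_k s_k}{\gamma_k-1},\qquad s_k=\ln\Big((\gamma_k-1)\Big(E_k-\frac{1}{2\rho_k}\|\rho_k\vec v_k\|^2-\frac12\|\vec B\|^2\Big)\Big)-\gamma_k\ln\rho_k ,$$ on the set of admissible states. Then $S$ is strictly convex with respect to $\mathbf u$. Its gradient $\mathbf w=\partial S/\partial\mathbf u$ is given by the components $$\frac{\partial S}{\partial\rho_k}=\frac{\gamma_k-s_k}{\gamma_k-1}-\beta_k\|\vec v_k\|^2,\quad \frac{\partial S}{\partial(\rho_k\vec v_k)}=2\beta_k\vec v_k,\quad \frac{\partial S}{\partial E_k}=-2\beta_k\quad(k=1,\dots,N_i),\qquad \frac{\partial S}{\partial\vec B}=2\beta_+\vec B,$$ and the map $\mathbf u\mapsto\mathbf w$ is a bijection from the set of admissible states onto its image.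
   Context: There are $N_i\ge1$ ion species with constants $\gamma_k>1$ (heat capacity ratios). For species $k$, $\rho_k$ is the density, $\vec v_k\in\mathbb R^3$ the velocity, $p_k$ the pressure, and $\mathcal E_k=\tfrac12\rho_k\|\vec v_k\|^2+\frac{p_k}{\gamma_k-1}$ the hydrodynamic energy; $\vec B\in\mathbb R^3$ is the magnetic field, common to all species. The state vector $\mathbf u\in\mathbb R^{5N_i+3}$ consists of all the $\rho_k$, $\rho_k\vec v_k$, $E_k$ ($k=1,\dots,N_i$) and $\vec B$, treated as independent variables, so that $p_k=(\gamma_k-1)\big(E_k-\frac{1}{2\rho_k}\|\rho_k\vec v_k\|^2-\frac12\|\vec B\|^2\big)$. A state is admissible if $\rho_k>0$ and $p_k>0$ for every $k$. Set $\beta_k=\frac{\rho_k}{2p_k}$ and $\beta_+=\sum_{k=1}^{N_i}\beta_k$. Note $s_k=\ln p_k-\gamma_k\ln\rho_k$. *)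

(* Defs.v *)
From HB Require Import structures.
From mathcomp Require Import all_boot all_order all_algebra.
From mathcomp Require Import all_classical all_reals all_analysis.
Set Implicit Arguments.
Unset Strict Implicit.
Unset Printing Implicit Defensive.
Import Order.TTheory GRing.Theory Num.Theory.
Import numFieldNormedType.Exports.
Local Open Scope classical_set_scope.
Local Open Scope ring_scope.

(* State vectors u = (rho, m, E, B) of R^(5N+3), grouped by kind of variable:
   row k of the N x 3 matrix m is the momentum rho_k v_k of species k. *)
Notation state R N :=
  ('rV[R]_N * 'M[R]_(N, 3) * 'rV[R]_N * 'rV[R]_3)%type.

Definition sqnorm (R : realType) (n : nat) (x : 'rV[R]_n) : R :=
  \sum_(i < n) x ord0 i ^+ 2.

(* Slots of a vector of R^(5N+3); also used on gradients, whose slots are the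
   partial derivatives with respect to the corresponding variables. *)
Definition density (R : realType) (N : nat) (u : state R N) (k : 'I_N) : R :=
  u.1.1.1 ord0 k.

Definition momentum (R : realType) (N : nat) (u : state R N) (k : 'I_N) :
  'rV[R]_3 := row k u.1.1.2.

Definition energy (R : realType) (N : nat) (u : state R N) (k : 'I_N) : R :=
  u.1.2 ord0 k.

Definition magnetic (R : realType) (N : nat) (u : state R N) : 'rV[R]_3 := u.2.

Section MultiIonMHD.
Variables (R : realType) (N : nat).
Variable gamma : 'I_N -> R.
Implicit Types (u : state R N) (k : 'I_N).

Definition velocity u k : 'rV[R]_3 := (density u k)^-1 *: momentum u k.

(* gamma k is the heat capacity ratio of species k.
   The energy slot is the total energy of the species, i.e. the hydrodynamic
   energy rho_k |v_k|^2 / 2 + p_k / (gamma_k - 1) plus |B|^2 / 2. *)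
Definition pressure u k : R :=
  (gamma k - 1) * (energy u k - (2 * density u k)^-1 * sqnorm (momentum u k)
                   - 2^-1 * sqnorm (magnetic u)).

Definition admissible : set (state R N) :=
  [set u | forall k, 0 < density u k /\ 0 < pressure u k].

Definition beta u k : R := density u k / (2 * pressure u k).

Definition beta_plus u : R := \sum_(k < N) beta u k.

Definition specific_entropy u k : R :=
  ln (pressure u k) - gamma k * ln (density u k).

Definition entropy u : R :=
  \sum_(k < N) - (density u k * specific_entropy u k) / (gamma k - 1).

End MultiIonMHD.

Definition gradient (R : realType) (N : nat) (f : state R N -> R)
    (u : state R N) : state R N :=
  (\row_(k < N) 'D_((delta_mx ord0 k, 0, 0, 0) : state R N) f u,
   \matrix_(k < N, i < 3) 'D_((0, delta_mx k i, 0, 0) : state R N) f u,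
   \row_(k < N) 'D_((0, 0, delta_mx ord0 k, 0) : state R N) f u,
   \row_(i < 3) 'D_((0, 0, 0, delta_mx ord0 i) : state R N) f u).

(* Strict counterpart of the library's convex_function, which, unlike here,
   does not require the domain to be a convex set. *)
Definition strictly_convex_function (R : realType) (E : lmodType R)
    (E' := convex_lmodType E) (D : set E') (f : E' -> R^o) : Prop :=
  convex_set D /\
  forall (t : {i01 R}) (x y : E'), x \in D -> y \in D -> x != y ->
    0 < t%:num -> t%:num < 1 ->
    (f (conv t x y) < conv t (f x : convex_lmodType R^o) (f y))%R.

(* Main.v *)
Require Import Defs.
From HB Require Import structures.
From mathcomp Require Import all_boot all_order all_algebra.
From mathcomp Require Import all_classical all_reals all_analysis.
From mathcomp Require Import ring lra.
Set Implicit Arguments.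
Unset Strict Implicit.
Unset Printing Implicit Defensive.
Import Order.TTheory GRing.Theory Num.Theory.
Import numFieldNormedType.Exports.
Local Open Scope classical_set_scope.
Local Open Scope ring_scope.

(** Everything reduces to one inequality: at each admissible [x] the entropy lies
strictly above its tangent hyperplane, that is
[S y > S x + w x . (y - x)] for every other admissible [y], where [w] denotes the
claimed gradient ([entropy_support]).

The inequality comes from an exact formula for the gap, species by species
([entropy_excess]).  Write [D a b = a (ln a - ln b) - a + b], which is
nonnegative and vanishes only at [a = b], because [ln t <= t - 1] with equality
only at [t = 1].  With primes for the quantities of [y], the contribution of a
species to the gap is
  [D rho' rho + D rho' (rho p' / p) / (gamma - 1)
   + beta (rho' |v' - v|^2 + |B' - B|^2)].
If the total gap vanishes, then density, pressure, velocity and magnetic field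
agree for each species, hence so do momentum and energy, and [x = y].

Strict convexity follows by taking the tangent hyperplane at the convex
combination ([supports_strictly_convex]); the admissible set is convex because
the pressure is a minimum of affine functions of the state ([pressure_le]).
Injectivity of the gradient follows because two distinct points cannot both
carry a strict support with the same linear part ([strict_support_inj]).  The
same inequality also computes the gradient: once the entropy is known to be
differentiable, an affine minorant touching it at an interior point must be its
tangent ([derive_support]), so no derivative of the entropy is calculated. *)

(** * Strictly supporting affine functions *)

Definition strict_support (R : realType) (V : lmodType R) (f : V -> R)
    (D : set V) (x : V) (l : {scalar V}) : Prop :=
  forall y, D y -> y != x -> f x + l (y - x) < f y.

Section Supports.
Context {R : realType} {V : lmodType R}.
Implicit Types (f : V -> R) (D : set V) (l : {scalar V}).

(** Writing [z] for the convex combination of [x] and [y], average the support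
inequalities at [z] evaluated at [x] and at [y]: the linear terms cancel. *)
Lemma supports_strictly_convex f D (l : V -> {scalar V}) :
  convex_set (D : set (convex_lmodType V)) ->
  (forall x, D x -> strict_support f D x (l x)) ->
  strictly_convex_function D f.
Proof.
move=> cvxD suppf; split=> // t; set a := t%:num.
move=> x y xD yD xy a0 a1.
have zD := cvxD x y t xD yD; rewrite !inE in xD yD zD.
set z : V := conv t x y in zD *; pose d : V := x - y.
have zE : z = y + a *: d.
  by rewrite /d scalerBr addrCA /z /conv /= scalerBl scale1r.
have xz : x - z = (1 - a) *: d by rewrite zE opprD addrA scalerBl scale1r.
have yz : y - z = - a *: d by rewrite zE opprD addrA subrr add0r scaleNr.
have d0 : d != 0 by rewrite subr_eq0.
have fx : f z + l z (x - z) < f x.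
  by apply: suppf => //; rewrite -subr_eq0 xz scaler_eq0 negb_or d0 subr_eq0 gt_eqF.
have fy : f z + l z (y - z) < f y.
  by apply: suppf => //; rewrite -subr_eq0 yz scaler_eq0 negb_or d0 oppr_eq0 gt_eqF.
change (f z < a * f x + (1 - a) * f y).
rewrite xz linearZ /= in fx; rewrite yz linearZ /= in fy.
have b0 : 0 < 1 - a by rewrite subr_gt0.
rewrite -(ltr_pM2l a0) in fx; rewrite -(ltr_pM2l b0) in fy.
by apply: le_lt_trans (ltrD fx fy); rewrite le_eqVlt; apply/orP/or_introl/eqP; ring.
Qed.

(** Adding the two support inequalities, each evaluated at the other point,
would give [0 < 0]. *)
Lemma strict_support_inj f D l x y :
  D x -> D y -> strict_support f D x l -> strict_support f D y l -> x = y.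
Proof.
move=> Dx Dy fx fy; apply: contrapT => /eqP xy.
have {}fy := fy x Dx xy; rewrite eq_sym in xy; have {}fx := fx y Dy xy.
by rewrite -opprB linearN /= in fx; lra.
Qed.

End Supports.

(** For small [h > 0] the support inequality bounds the difference quotient in a
direction [w] below by [l w].  Applying this to [w = v] and to [w = - v] gives
both inequalities, as the derivative is linear in the direction. *)
Lemma derive_support (R : realType) (V : normedModType R) (f : V -> R)
    (D : set V) (x v : V) (l : {scalar V}) :
  differentiable f x -> nbhs x D -> strict_support f D x l ->
  'D_v f x = l v.
Proof.
move=> df nD supp.
have ge w : l w <= 'D_w f x.
  have near0 : \forall h \near (0 : R), D (h *: w + x).
    have : h *: w + x @[h --> (0 : R)] --> 0 *: w + x.
      by apply: cvgD; [apply: cvgZr_tmp; exact: cvg_id | exact: cvg_cst].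
    by rewrite scale0r add0r => /(_ _ nD).
  have cv : h^-1 *: (f (h *: w + x) - f x) @[h --> (0:R)^'+] --> 'D_w f x.
    exact: cvg_dnbhs_at_right (diff_derivable df).
  rewrite -(cvg_lim _ cv) //; apply: limr_ge; first exact: cvgP cv.
  near=> h.
  have h0 : 0 < h by near: h; exact: nbhs_right_gt.
  rewrite ler_pdivlMl // -linearZ /=.
  have [->|hw] := eqVneq (h *: w) 0; first by rewrite linear0 add0r subrr.
  have := supp (h *: w + x); rewrite addrK lerBrDl => lt_f; apply/ltW/lt_f.
    by near: h; exact: cvg_at_right_filter cvg_id _ near0.
  by rewrite -subr_eq0 addrK.
apply/eqP; rewrite eq_le ge andbT -lerN2.
by have := ge (- v); rewrite !deriveE // !linearN.
Unshelve. all: by end_near.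
Qed.

(** * The Euclidean inner product *)

Definition dot (R : realType) (n : nat) (x y : 'rV[R]_n) : R :=
  \sum_(i < n) x ord0 i * y ord0 i.

Section Dot.
Context {R : realType} {n : nat}.
Implicit Types (x y z : 'rV[R]_n) (a : R).

Lemma sqnormE x : sqnorm x = dot x x.
Proof. by apply: eq_bigr => i _; rewrite expr2. Qed.

Lemma dot_is_linear x : scalar (dot x).
Proof.
move=> a y z; rewrite /dot mulr_sumr -big_split; apply: eq_bigr => i _ /=.
by rewrite !mxE; ring.
Qed.

HB.instance Definition _ x :=
  GRing.isLinear.Build R 'rV[R]_n R *%R (dot x) (dot_is_linear x).

Lemma dot0r x : dot x 0 = 0.
Proof. exact: linear0. Qed.

Lemma dotZr x a y : dot x (a *: y) = a * dot x y.
Proof. exact: linearZ. Qed.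

Lemma dotBr x y z : dot x (y - z) = dot x y - dot x z.
Proof. exact: linearB. Qed.

Lemma dotC x y : dot x y = dot y x.
Proof. by apply: eq_bigr => i _; rewrite mulrC. Qed.

Lemma dotZl x a y : dot (a *: x) y = a * dot x y.
Proof. by rewrite dotC dotZr dotC. Qed.

Lemma sqnorm_ge0 x : 0 <= sqnorm x.
Proof. by apply: sumr_ge0 => i _; exact: sqr_ge0. Qed.

Lemma sqnorm_eq0 x : (sqnorm x == 0) = (x == 0).
Proof.
apply/eqP/eqP => [x0|->]; last by apply: big1 => i _; rewrite mxE expr0n.
apply/rowP => i; rewrite mxE; apply/eqP; rewrite -sqrf_eq0; apply/eqP.
exact: (psumr_eq0P (fun j _ => sqr_ge0 (x ord0 j)) x0).
Qed.

Lemma sqnormB x y : sqnorm (x - y) = sqnorm x - 2 * dot x y + sqnorm y.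
Proof.
rewrite /sqnorm /dot mulr_sumr -sumrB -big_split; apply: eq_bigr => i _ /=.
by rewrite !mxE; ring.
Qed.

Lemma sqnormZ a x : sqnorm (a *: x) = a ^+ 2 * sqnorm x.
Proof. by rewrite /sqnorm mulr_sumr; apply: eq_bigr => i _; rewrite mxE exprMn. Qed.

End Dot.

(** * The duality pairing of states and gradients *)

Section Pairing.
Context {R : realType} {N : nat}.
Implicit Types (u v w : state R N).

Definition pairing w u : R :=
  \sum_(k < N) (density w k * density u k + dot (momentum w k) (momentum u k)
                + energy w k * energy u k)
  + dot (magnetic w) (magnetic u).

Lemma densityP a u v k :
  density (a *: u + v) k = a * density u k + density v k.
Proof. by rewrite /density /= !mxE. Qed.

Lemma energyP a u v k : energy (a *: u + v) k = a * energy u k + energy v k.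
Proof. by rewrite /energy /= !mxE. Qed.

Lemma momentumP a u v k :
  momentum (a *: u + v) k = a *: momentum u k + momentum v k.
Proof. by rewrite /momentum /= linearP. Qed.

Lemma magneticP a u v : magnetic (a *: u + v) = a *: magnetic u + magnetic v.
Proof. by []. Qed.

Lemma pairing_is_linear w : scalar (pairing w).
Proof.
move=> a u v; rewrite /pairing magneticP linearP mulrDr mulr_sumr addrACA.
rewrite -big_split /=; congr (_ + _); apply: eq_bigr => k _ /=.
by rewrite densityP energyP momentumP linearP /=; ring.
Qed.

HB.instance Definition _ w :=
  GRing.isLinear.Build R (state R N) R *%R (pairing w) (pairing_is_linear w).

Lemma dot_delta n (x : 'rV[R]_n) i : dot x (delta_mx ord0 i) = x ord0 i.
Proof.
rewrite /dot (bigD1 i) //= big1 ?addr0 => [|j ji]; rewrite !mxE !eqxx /=.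
  by rewrite mulr1.
by rewrite (negbTE ji) mulr0.
Qed.

Lemma row_delta m n (k j : 'I_m) (i : 'I_n) :
  row j (delta_mx k i) = if j == k then delta_mx ord0 i else 0 :> 'rV[R]_n.
Proof. by apply/rowP => l; rewrite !mxE; case: eqP => _; rewrite !mxE. Qed.

(** The slots of the gradient are the directional derivatives along the standard
basis, on which [pairing w] returns the slots of [w]. *)
Lemma gradient_pairing (f : state R N -> R) u w :
  (forall v, 'D_v f u = pairing w v) -> gradient f u = w.
Proof.
move=> Df; rewrite /gradient; case: w Df => [[[r m] e] b] Df.
congr (_, _, _, _).
- apply/rowP => k; rewrite mxE Df /pairing dot0r addr0 (bigD1 k) //=.
  rewrite big1 ?addr0 => [|j jk]; rewrite /momentum /density /energy /=.
    by rewrite row0 dot0r !mxE !eqxx mulr1 mulr0 !addr0.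
  by rewrite row0 dot0r !mxE (negbTE jk) andbF !mulr0 !addr0.
- apply/matrixP => k i; rewrite mxE Df /pairing dot0r addr0 (bigD1 k) //=.
  rewrite big1 ?addr0 => [|j jk]; rewrite /momentum /density /energy /=.
    by rewrite row_delta eqxx dot_delta !mxE !mulr0 addr0 add0r.
  by rewrite row_delta (negbTE jk) dot0r !mxE !mulr0 !addr0.
- apply/rowP => k; rewrite mxE Df /pairing dot0r addr0 (bigD1 k) //=.
  rewrite big1 ?addr0 => [|j jk]; rewrite /momentum /density /energy /=.
    by rewrite row0 dot0r !mxE !eqxx mulr1 mulr0 !add0r.
  by rewrite row0 dot0r !mxE (negbTE jk) andbF !mulr0 !addr0.
- apply/rowP => i; rewrite mxE Df /pairing dot_delta big1 ?add0r //= => k _.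
  by rewrite /momentum /density /energy /= row0 dot0r !mxE !mulr0 !addr0.
Qed.

End Pairing.

(** * Relative entropy of positive reals *)

(** The Bregman divergence of [t ln t]: the gap at [a] between this function and
its tangent at [b]. *)
Definition relative_entropy (R : realType) (a b : R) : R :=
  a * (ln a - ln b) - a + b.

Section RelativeEntropy.
Context {R : realType}.
Implicit Types a b : R.

(** This is [ln t < t - 1] for [t = b / a != 1], multiplied by [a]. *)
Lemma relative_entropy_gt0 a b :
  0 < a -> 0 < b -> a != b -> 0 < relative_entropy a b.
Proof.
move=> a0 b0 ab; have ba0 : 0 < b / a by exact: divr_gt0.
have lnba : ln (b / a) != 0.
  rewrite ln_eq0 //; apply: contra ab => /eqP ba.
  by rewrite -[b](divfK (lt0r_neq0 a0)) ba mul1r.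
have := expR_gt1Dx lnba; rewrite lnK // ln_div // ltr_pdivlMr //.
by rewrite /relative_entropy; lra.
Qed.

Lemma relative_entropy_ge0 a b :
  0 < a -> 0 < b -> 0 <= relative_entropy a b.
Proof.
move=> a0 b0; have [->|ab] := eqVneq a b; last exact/ltW/relative_entropy_gt0.
by rewrite /relative_entropy subrr mulr0 sub0r addNr.
Qed.

Lemma relative_entropy_eq0 a b :
  0 < a -> 0 < b -> relative_entropy a b = 0 -> a = b.
Proof.
move=> a0 b0 ab0; apply: contrapT => /eqP /(relative_entropy_gt0 a0 b0).
by rewrite ab0 ltxx.
Qed.

End RelativeEntropy.

(** * Differentiability of the state variables *)

Section SlotsDifferentiable.
Context {R : realType}.

Lemma differentiable_fst (V W : normedModType R) (p : V * W) :
  differentiable (fst : V * W -> V) p.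
Proof. by apply: linear_differentiable => q; exact: cvg_fst. Qed.

Lemma differentiable_snd (V W : normedModType R) (p : V * W) :
  differentiable (snd : V * W -> W) p.
Proof. by apply: linear_differentiable => q; exact: cvg_snd. Qed.

Lemma differentiable_sum_fun (V : normedModType R) n (f : 'I_n -> V -> R) (u : V) :
  (forall i, differentiable (f i) u) -> differentiable (fun v => \sum_(i < n) f i v) u.
Proof.
move=> /differentiable_sum; congr (differentiable _ _).
by apply/funext => v; rewrite fct_sumE.
Qed.

Lemma differentiable_sqnorm (V : normedModType R) n (F : V -> 'rV[R]_n) (u : V) :
  (forall i, differentiable (fun v => F v ord0 i) u) ->
  differentiable (fun v => sqnorm (F v)) u.
Proof.
move=> dF; apply: differentiable_sum_fun => i.
rewrite (_ : (fun _ => _) = (fun v => F v ord0 i) * (fun v => F v ord0 i)).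
  exact: differentiableM.
by apply/funext => v; rewrite expr2.
Qed.

Lemma differentiable_ln (V : normedModType R) (f : V -> R) (u : V) : 0 < f u ->
  differentiable f u -> differentiable (fun v => ln (f v)) u.
Proof.
move=> f0 df; apply: (differentiable_comp df).
by apply/derivable1_diffP; apply: ex_derive; exact: is_derive1_ln.
Qed.

Context {N : nat}.
Implicit Types (u v : state R N) (k : 'I_N).

Lemma differentiable_density u k : differentiable (@density R N ^~ k) u.
Proof.
apply: (differentiable_comp (g := fun M : 'rV[R]_N => M ord0 k));
  last exact: differentiable_coord.
do 2 (apply: (differentiable_comp _ (differentiable_fst _))).
exact: differentiable_fst.
Qed.

Lemma differentiable_momentum u k i :
  differentiable (fun v : state R N => momentum v k ord0 i) u.
Proof.
rewrite (_ : (fun _ => _) = (fun M : 'M[R]_(N, 3) => M k i) \o snd \o fst \o fst); last first.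
  by apply/funext => v; rewrite /momentum mxE.
do 2 apply: differentiable_comp (differentiable_fst _) _.
apply: differentiable_comp (differentiable_snd _) _.
exact: differentiable_coord.
Qed.

Lemma differentiable_energy u k : differentiable (@energy R N ^~ k) u.
Proof.
apply: (differentiable_comp (g := fun M : 'rV[R]_N => M ord0 k));
  last exact: differentiable_coord.
exact: differentiable_comp (differentiable_fst _) (differentiable_snd _).
Qed.

Lemma differentiable_magnetic u i :
  differentiable (fun v : state R N => magnetic v ord0 i) u.
Proof.
apply: (differentiable_comp (g := fun M : 'rV[R]_3 => M ord0 i)).
  exact: differentiable_snd.
exact: differentiable_coord.
Qed.

End SlotsDifferentiable.

(** * Admissible states and entropy *)

Section MHD.
Context {R : realType} {N : nat} {gamma : 'I_N -> R}.
Context (gamma_gt1 : forall k, 1 < gamma k).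
Implicit Types (u x y z : state R N) (k : 'I_N).

Let g_gt0 k : 0 < gamma k - 1.
Proof. by rewrite subr_gt0. Qed.

Lemma momentumE u k : density u k != 0 -> momentum u k = density u k *: velocity u k.
Proof. by move=> r0; rewrite /velocity scalerA mulfV // scale1r. Qed.

(** Completing squares: the quadratic terms of the pressure are replaced by their
tangents at an arbitrary velocity [v] and field [b], up to an explicit square. *)
Lemma pressureE u k (v b : 'rV[R]_3) : density u k != 0 ->
  pressure gamma u k = (gamma k - 1) *
    (energy u k - dot v (momentum u k) + sqnorm v / 2 * density u k
     - dot b (magnetic u) + sqnorm b / 2
     - (density u k * sqnorm (v - velocity u k) + sqnorm (b - magnetic u)) / 2).
Proof.
move=> r0; rewrite /pressure momentumE // sqnormZ !sqnormB dotZr.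
by field.
Qed.

(** The right-hand side is affine in the state, with equality when [v] and [b] are
the velocity and field of [u]; so the pressure is a minimum of affine functions
wherever the density is positive, hence concave there. *)
Lemma pressure_le u k (v b : 'rV[R]_3) : 0 < density u k ->
  pressure gamma u k <= (gamma k - 1) *
    (energy u k - dot v (momentum u k) + sqnorm v / 2 * density u k
     - dot b (magnetic u) + sqnorm b / 2).
Proof.
move=> r0; rewrite (pressureE v b) ?gt_eqF // ler_pM2l // gerBl.
by rewrite divr_ge0 // addr_ge0 ?sqnorm_ge0 // mulr_ge0 ?sqnorm_ge0 // ltW.
Qed.

Lemma admissible_convex :
  convex_set (admissible gamma : set (convex_lmodType (state R N))).
Proof.
apply/convex_setW => x y; rewrite !inE => xA yA t.
set a := t%:num => a0 a1; rewrite inE => k.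
have [rx px] := xA k; have [ry py] := yA k.
have b0 : 0 < 1 - a by rewrite subr_gt0.
set z : state R N := conv t x y.
have zE : z = a *: (x : state R N) + ((1 - a) *: (y : state R N) + 0).
  by rewrite addr0.
have rz : density z k = a * density x k + (1 - a) * density y k.
  by rewrite zE !densityP [density 0 k]mxE addr0.
have rz0 : 0 < density z k by rewrite rz addr_gt0 // mulr_gt0.
split => //.
(* This choice makes the affine bound exact at z. *)
pose v := velocity z k; pose b := magnetic z.
have lex := pressure_le v b rx; have ley := pressure_le v b ry.
apply: (@lt_le_trans _ _ (a * pressure gamma x k + (1 - a) * pressure gamma y k)).
  by rewrite addr_gt0 // mulr_gt0.
have sq0 : sqnorm (0 : 'rV[R]_3) = 0 by apply/eqP; rewrite sqnorm_eq0.
rewrite (@pressureE z k v b) ?gt_eqF // [v - _]subrr [b - _]subrr sq0 mulr0 addr0 mul0r subr0.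
have -> : energy z k = a * energy x k + (1 - a) * energy y k.
  by rewrite zE !energyP [energy 0 k]mxE addr0.
have -> : momentum z k = a *: momentum x k + (1 - a) *: momentum y k.
  by rewrite zE !momentumP [momentum 0 k]linear0 addr0.
have -> : magnetic z = a *: magnetic x + (1 - a) *: magnetic y.
  by rewrite zE !magneticP addr0.
rewrite ![dot _ (_ + _)]linearD /= !dotZr rz.
apply: le_trans (lerD (ler_wpM2l (ltW a0) lex) (ler_wpM2l (ltW b0) ley)) _.
by rewrite le_eqVlt; apply/orP/or_introl/eqP; ring.
Qed.

Definition entropy_variables u : state R N :=
  (\row_k ((gamma k - specific_entropy gamma u k) / (gamma k - 1)
           - beta gamma u k * sqnorm (velocity u k)),
   \matrix_(k, i) ((2 * beta gamma u k) *: velocity u k) ord0 i,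
   \row_k - (2 * beta gamma u k),
   (2 * beta_plus gamma u) *: magnetic u).

Lemma density_entropy_variables u k :
  density (entropy_variables u) k =
  (gamma k - specific_entropy gamma u k) / (gamma k - 1)
  - beta gamma u k * sqnorm (velocity u k).
Proof. by rewrite /density /= mxE. Qed.

Lemma momentum_entropy_variables u k :
  momentum (entropy_variables u) k = (2 * beta gamma u k) *: velocity u k.
Proof. by apply/rowP => i; rewrite /momentum /= !mxE. Qed.

Lemma energy_entropy_variables u k :
  energy (entropy_variables u) k = - (2 * beta gamma u k).
Proof. by rewrite /energy /= mxE. Qed.

(** Contribution of species [k] to the gap at [y] between the entropy and its
tangent at [x]. *)
Definition excess x y k : R :=
  relative_entropy (density y k) (density x k)
  + (gamma k - 1)^-1 * relative_entropy (density y k)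
      (density x k * (pressure gamma y k / pressure gamma x k))
  + beta gamma x k * (density y k * sqnorm (velocity y k - velocity x k)
                      + sqnorm (magnetic y - magnetic x)).

(** Parametrizing a state by density, velocity, pressure and field instead of the
conserved variables turns the gap formula below into a rational identity. *)
Lemma energyE u k : density u k != 0 ->
  energy u k = pressure gamma u k / (gamma k - 1)
    + density u k * sqnorm (velocity u k) / 2 + sqnorm (magnetic u) / 2.
Proof.
move=> r0; rewrite /pressure momentumE // sqnormZ.
by field; rewrite r0 gt_eqF.
Qed.

(** The part of the gap that pairs the magnetic slots carries the factor
[beta_plus]; distributing it over the species makes the identity hold term by
term, and it is then rational in the remaining scalars and logarithms. *)
Lemma entropy_excess x y : admissible gamma x -> admissible gamma y ->
  entropy gamma y - entropy gamma x - pairing (entropy_variables x) (y - x) =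
  \sum_(k < N) excess x y k.
Proof.
move=> xA yA; rewrite /pairing /entropy -sumrB opprD addrA -sumrB.
have -> : magnetic (entropy_variables x) = (2 * beta_plus gamma x) *: magnetic x by [].
rewrite dotZl /beta_plus -mulrA mulr_suml mulr_sumr -sumrB; apply: eq_bigr => k _.
have [rx px] := xA k; have [ry py] := yA k.
rewrite density_entropy_variables momentum_entropy_variables.
rewrite energy_entropy_variables dotZl.
have -> : density (y - x) k = density y k - density x k by rewrite /density !mxE.
have -> : energy (y - x) k = energy y k - energy x k by rewrite /energy !mxE.
have -> : momentum (y - x) k = momentum y k - momentum x k by rewrite /momentum linearB.
have -> : magnetic (y - x) = magnetic y - magnetic x by [].
rewrite /excess !momentumE ?gt_eqF // !energyE ?gt_eqF //.
move: (velocity x k) (velocity y k) => vx vy.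
rewrite !sqnormB !dotBr !dotZr -!sqnormE [dot vy _]dotC [dot (magnetic y) _]dotC.
rewrite /relative_entropy lnM ?posrE ?divr_gt0 // ln_div //.
rewrite /specific_entropy /beta.
field.
by rewrite !gt_eqF.
Qed.

Lemma excess_terms_ge0 x y k : admissible gamma x -> admissible gamma y ->
  [/\ 0 <= relative_entropy (density y k) (density x k),
      0 <= (gamma k - 1)^-1 * relative_entropy (density y k)
             (density x k * (pressure gamma y k / pressure gamma x k)),
      0 <= density y k * sqnorm (velocity y k - velocity x k)
    & 0 < beta gamma x k].
Proof.
move=> /(_ k)[rx px] /(_ k)[ry py]; split.
- exact: relative_entropy_ge0.
- apply: mulr_ge0; first by rewrite invr_ge0 ltW.
  by apply: relative_entropy_ge0 => //; rewrite mulr_gt0 ?divr_gt0.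
- by apply: mulr_ge0; [exact: ltW | exact: sqnorm_ge0].
- by rewrite /beta divr_gt0 // mulr_gt0.
Qed.

Lemma excess_ge0 x y k : admissible gamma x -> admissible gamma y ->
  0 <= excess x y k.
Proof.
move=> xA yA; have [r0 p0 v0 b0] := excess_terms_ge0 k xA yA.
apply: addr_ge0; first exact: addr_ge0.
by apply: mulr_ge0; [exact: ltW | exact: addr_ge0 (sqnorm_ge0 _)].
Qed.

(** All three nonnegative parts of the excess vanish: the first gives equal
densities, the second then equal pressures, the third equal velocities and
fields. *)
Lemma excess_eq0 x y k : admissible gamma x -> admissible gamma y ->
  excess x y k = 0 ->
  [/\ density y k = density x k, momentum y k = momentum x k,
      energy y k = energy x k & magnetic y = magnetic x].
Proof.
move=> xA yA; have [r0 p0 v0 b0] := excess_terms_ge0 k xA yA.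
have [rx px] := xA k; have [ry py] := yA k.
have B0 := sqnorm_ge0 (magnetic y - magnetic x).
have C0 : 0 <= beta gamma x k *
    (density y k * sqnorm (velocity y k - velocity x k)
     + sqnorm (magnetic y - magnetic x)).
  by apply: mulr_ge0; [exact: ltW | exact: addr_ge0].
have sum_eq0 (a b c : R) : 0 <= a -> 0 <= b -> 0 <= c -> a + b + c = 0 ->
    [/\ a = 0, b = 0 & c = 0] by move=> *; split; lra.
case/(sum_eq0 _ _ _ r0 p0 C0) => er /eqP ep /eqP.
rewrite mulf_eq0 gt_eqF //= paddr_eq0 // mulf_eq0 gt_eqF //=.
rewrite !sqnorm_eq0 !subr_eq0 => /andP[/eqP ev /eqP eB].
move: ep; rewrite mulf_eq0 invr_eq0 gt_eqF //= => /eqP ep.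
have {}er := relative_entropy_eq0 ry rx er.
have {}ep : pressure gamma y k = pressure gamma x k.
  have q0 : 0 < density x k * (pressure gamma y k / pressure gamma x k).
    by rewrite mulr_gt0 ?divr_gt0.
  have := relative_entropy_eq0 ry q0 ep; rewrite er => /esym/eqP.
  rewrite -[X in _ == X]mulr1 => /eqP/(mulfI (lt0r_neq0 rx)).
  exact: divr1_eq.
split=> //; first by rewrite !momentumE ?gt_eqF // er ev.
by rewrite !energyE ?gt_eqF // er ep ev eB.
Qed.

(** At least one species is needed for a vanishing gap to force equal magnetic
fields, since the field enters the gap only through the species. *)
Lemma entropy_support x : (0 < N)%N -> admissible gamma x ->
  strict_support (entropy gamma) (admissible gamma) x (pairing (entropy_variables x)).
Proof.
move=> N0 xA y yA yx; rewrite -subr_gt0 opprD addrA entropy_excess //.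
rewrite lt0r sumr_ge0 ?andbT => [|k _]; last exact: excess_ge0.
apply: contra yx => /eqP sum0.
have same k := excess_eq0 xA yA
  (psumr_eq0P (fun j _ => excess_ge0 j xA yA) sum0 (i := k) isT).
have [_ _ _ eqB] := same (Ordinal N0).
have eqr : y.1.1.1 = x.1.1.1 by apply/rowP => k; have [] := same k.
have eqm : y.1.1.2 = x.1.1.2 by apply/row_matrixP => k; have [] := same k.
have eqE : y.1.2 = x.1.2 by apply/rowP => k; have [] := same k.
by move: eqr eqm eqE eqB; case: x y {xA yA sum0 same} => [[[? ?] ?] ?] [[[? ?] ?] ?];
   rewrite /magnetic /= => -> -> -> ->.
Qed.

Lemma differentiable_pressure u k : 0 < density u k ->
  differentiable (pressure gamma ^~ k) u.
Proof.
move=> r0; apply: differentiableM; first exact: differentiable_cst.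
apply: differentiableB; first apply: differentiableB.
- exact: differentiable_energy.
- apply: differentiableM.
    apply: differentiableV; last by rewrite mulf_neq0 // gt_eqF.
    apply: differentiableM; first exact: differentiable_cst.
    exact: differentiable_density.
  by apply: differentiable_sqnorm => i; exact: differentiable_momentum.
- apply: differentiableM; first exact: differentiable_cst.
  by apply: differentiable_sqnorm => i; exact: differentiable_magnetic.
Qed.

Lemma admissible_nbhs u : admissible gamma u -> nbhs u (admissible gamma).
Proof.
move=> uA.
apply: (@filter_forall _ _
  (fun k v => 0 < density v k /\ 0 < pressure gamma v k) (nbhs u)) => k.
have [r0 p0] := uA k; apply: filterI.
  exact: (differentiable_continuous (differentiable_density u k) (lt_nbhsr r0)).
exact: (differentiable_continuous (differentiable_pressure r0) (lt_nbhsr p0)).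
Qed.

Lemma differentiable_entropy u : admissible gamma u ->
  differentiable (entropy gamma) u.
Proof.
move=> uA; apply: differentiable_sum_fun => k; have [r0 p0] := uA k.
have dr := differentiable_density u k.
apply: differentiableM; last exact: differentiable_cst.
apply: differentiableN; apply: differentiableM => //.
apply: differentiableB; first exact/differentiable_ln/differentiable_pressure.
by apply: differentiableM; [exact: differentiable_cst|exact: differentiable_ln].
Qed.

Lemma gradient_entropy u : (0 < N)%N -> admissible gamma u ->
  gradient (entropy gamma) u = entropy_variables u.
Proof.
move=> N0 uA; apply: gradient_pairing => v.
apply: derive_support (entropy_support N0 uA).
  exact: differentiable_entropy.
exact: admissible_nbhs.
Qed.

End MHD.

Theorem mainTheorem1 (R : realType) (N : nat) (hN : (1 <= N)%N)
    (gamma : 'I_N -> R) (hgamma : forall k : 'I_N, 1 < gamma k) :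
  [/\ strictly_convex_function (admissible gamma) (entropy gamma),
      forall u : state R N, admissible gamma u ->
        let w := gradient (entropy gamma) u in
        [/\ differentiable (entropy gamma) u,
            forall k : 'I_N,
              density w k =
                (gamma k - specific_entropy gamma u k) / (gamma k - 1)
                - beta gamma u k * sqnorm (velocity u k),
            forall k : 'I_N,
              momentum w k = (2 * beta gamma u k) *: velocity u k,
            forall k : 'I_N, energy w k = - (2 * beta gamma u k)
          & magnetic w = (2 * beta_plus gamma u) *: magnetic u]
    & set_bij (admissible gamma)
        (gradient (entropy gamma) @` admissible gamma)
        (gradient (entropy gamma))].
Proof.
split.
- apply: (supports_strictly_convex (l := fun x => pairing (entropy_variables (gamma := gamma) x))).
    exact: admissible_convex.
  by move=> x; exact: entropy_support.
- move=> u uA w; rewrite /w gradient_entropy //; split => //.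
  + exact: differentiable_entropy.
  + by move=> k; exact: density_entropy_variables.
  + by move=> k; exact: momentum_entropy_variables.
  + by move=> k; exact: energy_entropy_variables.
- split; [by move=> u uA; exists u | | by []].
  move=> x y; rewrite !inE => xA yA; rewrite !gradient_entropy // => wxy.
  apply: (strict_support_inj xA yA (entropy_support hgamma hN xA)).
  by rewrite wxy; exact: entropy_support.
Qed.
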